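(* Let $M$ be a compact metrizable space, $f\colon M\to M$ a homeomorphism, $R$ an equivalence relation on $M$ compatible with $f$, $M_R=M/R$ and $f_R$ the induced quotient homeomorphism of $M_R$. The following statements are equivalent. (1) $f_R$ is an Anosov homeomorphism. (2) There exist a metric $d$ on $M$ inducing the topology of $M$ and a constant $\alpha>0$ such that $f$ is $\alpha$-semi Anosov (with respect to $d$) and $R=R(d,\alpha)$.
   Context: An equivalence relation $R$ on $M$ (written $x\sim y$) is compatible with $f$ if for all $x,y\in M$: $x\sim y$ if and only if $f(x)\sim f(y)$. $M_R$ carries the quotient topology and $f_R[x]=[f(x)]$. For a homeomorphism $g$ of a compact metric space $(Y,\rho)$: - $g$ is expansive if there is $\alpha>0$ such that $\rho(g^nx,g^ny)\le\alpha$ for all $n\in\mathbb Z$ implies $x=y$. - A bi-sequence $(x_n)_{n\in\mathbb Z}$ in $Y$ is a $\delta$-pseudo orbit ($\delta>0$) if $\rho(gx_n,x_{n+1})<\delta$ for all $n\in\mathbb Z$; a point $x\in Y$ $\varepsilon$-shadows it if $\rho(g^nx,x_n)<\varepsilon$ for all $n\in\mathbb Z$. - For $\varepsilon,\delta>0$, $g$ has the $\varepsilon$-$\delta$ shadowing property if every $\delta$-pseudo orbit is $\varepsilon$-shadowed by some point of $Y$. $g$ has the shadowing property if for every $\varepsilon>0$ there is $\delta>0$ such that $g$ has the $\varepsilon$-$\delta$ shadowing property. - $g$ is an Anosov homeomorphism if it is expansive and has the shadowing property. On a compact metrizable space, expansiveness and the shadowing property do not depend on the choice of compatible metric; saying that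 $f_R$ is Anosov includes that $M_R$ is metrizable. For $0<\varepsilon\le\alpha$, $f\colon(M,d)\to(M,d)$ is $[\varepsilon,\alpha]$-expansive if $x,y\in M$ and $d(f^nx,f^ny)\le\alpha$ for all $n\in\mathbb Z$ implies $d(x,y)<\varepsilon$. For $\alpha>0$, $f$ is $\alpha$-semi Anosov if for some $\delta$ with $0<\delta\le\alpha/4$, $f$ is $[\delta/4,\alpha]$-expansive and has the $\frac{\alpha}{4}$-$\delta$ shadowing property. In that case $R(d,\alpha)$ is the equivalence relation on $M$ given by $x\sim y$ iff $d(f^nx,f^ny)\le\alpha$ for all $n\in\mathbb Z$. *)

(* Defs.v *)
From mathcomp Require Import all_boot all_order all_algebra.
From mathcomp Require Import all_classical all_reals.
From mathcomp Require Import topology.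

Set Implicit Arguments.
Unset Strict Implicit.
Unset Printing Implicit Defensive.

Import Order.TTheory GRing.Theory Num.Theory.
Local Open Scope classical_set_scope.
Local Open Scope quotient_scope.
Local Open Scope ring_scope.

Section Metrics.
Variables (R : realType) (T : topologicalType).
Implicit Type d : T -> T -> R.

(* Distances are kept unbundled, with the axioms of the factory [isMetric],
   because the library's [metricType] fixes one distance per type, whereas here
   distances on a given topological space are quantified over. *)
Record is_metric d : Prop := IsMetric {
  is_metric_xx : forall x, d x x = 0;
  is_metric_eq : forall x y, d x y = 0 -> x = y;
  is_metric_sym : forall x y, d x y = d y x;
  is_metric_triangle : forall y x z, d x z <= d x y + d y z
}.

Definition compatible_metric d : Prop :=
  is_metric d /\
  (nbhs : T -> set_system T) = nbhs_ball_ (fun x r => [set y | d x y < r]).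

End Metrics.

Definition metrizable (R : realType) (T : topologicalType) : Prop :=
  exists d : T -> T -> R, compatible_metric d.

Record homeo (T : topologicalType) := Homeo {
  homeo_fun :> T -> T;
  homeo_inv : T -> T;
  homeo_funK : cancel homeo_fun homeo_inv;
  homeo_invK : cancel homeo_inv homeo_fun;
  homeo_fun_continuous : continuous homeo_fun;
  homeo_inv_continuous : continuous homeo_inv
}.

Definition iterz (T : topologicalType) (f : homeo T) (n : int) : T -> T :=
  match n with
  | Posz k => iter k f
  | Negz k => iter k.+1 (homeo_inv f)
  end.

Section Dynamics.
Variables (R : realType) (T : topologicalType).
Variables (d : T -> T -> R) (g : homeo T).

Definition expansive : Prop :=
  exists2 alpha : R, 0 < alpha &
    forall x y, (forall n, d (iterz g n x) (iterz g n y) <= alpha) -> x = y.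

Definition pseudo_orbit (delta : R) (x : int -> T) : Prop :=
  forall n, d (g (x n)) (x (n + 1)) < delta.

Definition shadows (eps : R) (p : T) (x : int -> T) : Prop :=
  forall n, d (iterz g n p) (x n) < eps.

Definition eps_delta_shadowing (eps delta : R) : Prop :=
  forall x, pseudo_orbit delta x -> exists p, shadows eps p x.

Definition shadowing : Prop :=
  forall eps, 0 < eps -> exists2 delta, 0 < delta & eps_delta_shadowing eps delta.

(* The relation written R(d, alpha). *)
Definition orbit_close (alpha : R) (x y : T) : Prop :=
  forall n, d (iterz g n x) (iterz g n y) <= alpha.

(* Only used with 0 < eps <= alpha. *)
Definition interval_expansive (eps alpha : R) : Prop :=
  forall x y, (forall n, d (iterz g n x) (iterz g n y) <= alpha) -> d x y < eps.

Definition semi_anosov (alpha : R) : Prop :=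
  exists delta, [/\ 0 < delta <= alpha / 4, interval_expansive (delta / 4) alpha
    & eps_delta_shadowing (alpha / 4) delta].

End Dynamics.

(* On a compact metrizable space, expansiveness and shadowing do not depend on
   the compatible distance; the existential also asserts metrizability. *)
Definition anosov (R : realType) (T : topologicalType) (g : homeo T) : Prop :=
  exists d : T -> T -> R, [/\ compatible_metric d, expansive d g & shadowing d g].

Definition compatible_rel (T : topologicalType) (f : homeo T)
    (E : equiv_rel T) : Prop :=
  forall x y, E x y <-> E (f x) (f y).

Section Quotient.
Variables (T : topologicalType) (f : homeo T) (E : equiv_rel T).
Hypothesis fE : compatible_rel f E.

Definition quot_space : topologicalType := quotient_topology {eq_quot E}.

Definition quot_map (h : T -> T) (c : quot_space) : quot_space :=
  \pi_quot_space (h (repr c)).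

Lemma quot_piP x y :
  reflect (\pi_quot_space x = \pi_quot_space y) (E x y).
Proof. exact: (@eqmodP _ E x y). Qed.

Lemma quot_mapE (h : T -> T) (hE : forall x y, E x y -> E (h x) (h y)) x :
  quot_map h (\pi_quot_space x) = \pi_quot_space (h x).
Proof.
apply/quot_piP/hE/quot_piP; exact: (@reprK _ quot_space).
Qed.

Lemma quot_map_continuous (h : T -> T) (hE : forall x y, E x y -> E (h x) (h y)) :
  continuous h -> continuous (quot_map h).
Proof.
move=> ch; apply/(@quotient_continuous _ {eq_quot E}).
have -> : quot_map h \o \pi_quot_space = \pi_quot_space \o h.
  by apply/funext => x; exact: quot_mapE.
move=> x; apply: continuous_comp; first exact: ch.
exact: (@pi_continuous _ {eq_quot E}).
Qed.

Let homE x y : E x y -> E (f x) (f y).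
Proof. by move/fE. Qed.

Let invE x y : E x y -> E (homeo_inv f x) (homeo_inv f y).
Proof. by move=> xy; apply/fE; rewrite !homeo_invK. Qed.

Lemma quot_funK : cancel (quot_map f) (quot_map (homeo_inv f)).
Proof.
by move=> c; rewrite -(@reprK _ quot_space c) (quot_mapE homE)
  (quot_mapE invE) homeo_funK.
Qed.

Lemma quot_invK : cancel (quot_map (homeo_inv f)) (quot_map f).
Proof.
by move=> c; rewrite -(@reprK _ quot_space c) (quot_mapE invE)
  (quot_mapE homE) homeo_invK.
Qed.

Definition quot_homeo : homeo quot_space :=
  Homeo quot_funK quot_invK
    (quot_map_continuous homE (@homeo_fun_continuous _ f))
    (quot_map_continuous invE (@homeo_inv_continuous _ f)).

Lemma quot_homeoE x : quot_homeo (\pi_quot_space x) = \pi_quot_space (f x).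
Proof. exact: quot_mapE. Qed.

End Quotient.

(* Main.v *)
(** (1) => (2): for a metric [D] on the quotient adapted to [f_R], take
    [max (D (pi x) (pi y), k * d x y)] with [k] so small that the second term stays
    below [delta / 4]; closeness of orbits and shadowing are then those of [f_R].

    (2) => (1): with [c = delta / 4], the Bowen relations
    [U_n = {(x, y) | d (f^i x) (f^i y) <= c for |i| <= n}] decrease to [R], since
    [R]-equivalent points are [c]-close. By compactness some [U_m o U_m] lies in
    [U_n], so the [U_n] induce a countable uniformity on [M_R], whose metric defines
    the quotient topology. A fine pseudo-orbit of [f_R] lifts to a pseudo-orbit of
    [f] for [U_m]; the [alpha / 4]-shadowing point stays [alpha]-close to it on long
    time windows, hence, by compactness again, in [U_n]. *)

Require Import Defs.
From HB Require Import structures.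
From mathcomp Require Import all_boot all_order all_algebra.
From mathcomp Require Import all_classical all_reals.
From mathcomp Require Import topology normedtype.
From mathcomp Require Import zify ring lra.

Set Implicit Arguments.
Unset Strict Implicit.
Unset Printing Implicit Defensive.

Import Order.TTheory GRing.Theory Num.Theory.
Import numFieldNormedType.Exports.
Local Open Scope classical_set_scope.
Local Open Scope quotient_scope.
Local Open Scope ring_scope.

(** * Metrics from a countable base of a uniformity *)

Section CountableBase.
Variables (T : topologicalType) (V : nat -> T -> T -> Prop).
Hypothesis V_refl : forall n x, V n x x.
Hypothesis V_sym : forall n x y, V n x y -> V n y x.
Hypothesis V_decr : forall m n x y, (m <= n)%N -> V n x y -> V m x y.
Hypothesis V_split : forall n, exists m, forall x y z,
  V m x y -> V m y z -> V n x z.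

Let ent : set_system (T * T) :=
  filter_from [set: nat] (fun n => [set xy | V n xy.1 xy.2]).

Let ent_filter : Filter ent.
Proof.
apply: filter_from_filter; first by exists 0%N.
move=> i j _ _; exists (maxn i j) => // -[x y] /= Vxy.
by split; apply: V_decr Vxy; rewrite ?leq_maxl ?leq_maxr.
Qed.

Let ent_refl A : ent A -> diagonal `<=` A.
Proof. by move=> [n _ VA] [x _] /diagonalP <-; apply: VA; exact: V_refl. Qed.

Let ent_inv A : ent A -> ent (A^-1)%relation.
Proof. by move=> [n _ VA]; exists n => // -[x y] /= /V_sym /(VA (y, x)). Qed.

Let ent_split A : ent A -> exists2 B, ent B & (B \; B)%relation `<=` A.
Proof.
move=> [n _ VA]; have [m Vmn] := V_split n.
exists [set xy | V m xy.1 xy.2]; first by exists m.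
by move=> [x z] [y /= Vxy Vyz]; apply: VA; exact: Vmn Vyz.
Qed.

(* The phantom bindings keep the instances below from applying to [T] itself. *)
Definition countable_base_type : Type :=
  let _ := V_refl in let _ := V_sym in let _ := V_decr in let _ := V_split in T.

HB.instance Definition _ := Choice.on countable_base_type.
HB.instance Definition _ :=
  @isUniform.Build countable_base_type ent ent_filter ent_refl ent_inv ent_split.

Let countable_base_countable : countable_uniformity countable_base_type.
Proof.
apply/countable_uniformityP; exists (fun n => [set xy | V n xy.1 xy.2]).
  by move=> A [n _ VA]; exists n.
by move=> n; exists n.
Qed.

(** A countable uniformity is pseudometrizable, but the pseudometric comes only as a family of
    balls; the distance is recovered as the infimum of the admissible radii. The last two clauses
    say that this distance and [V] generate the same uniformity; the topology of [T] plays no part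
    here and is compared in [quot_metric]. *)
Lemma countable_base_metric (R : realType) :
  (forall x y, (forall n, V n x y) -> x = y) ->
  exists d : T -> T -> R, [/\ is_metric d,
    forall n, exists2 r, 0 < r & forall x y, d x y < r -> V n x y
    & forall r, 0 < r -> exists n, forall x y, V n x y -> d x y < r].
Proof.
move=> V_sep.
pose X : pseudoMetricType R := countable_uniform countable_base_countable.
(* Any two points lie within radius 2, so each set of radii is nonempty and its infimum is
   meaningful. *)
have ball_bounded (x y : X) : ball x 2 y.
  exact: countable_uniform.countable_uniform_bounded.
pose radii (x y : X) : set R := [set r | 0 < r /\ ball x r y].
have radii2 x y : radii x y 2 by split => //; exact: ball_bounded.
have radii_lb x y : lbound (radii x y) 0 by move=> r [/ltW].
have radii_inf x y : has_inf (radii x y).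
  by split; [exists 2; exact: radii2 | exists 0; exact: radii_lb].
pose d (x y : T) : R := inf (radii x y).
have d_ball x y r : d x y < r -> ball (x : X) r (y : X).
  move=> /(inf_lt (radii_inf x y).1) [s [s0 xy] sr].
  exact: le_ball (ltW sr) _ xy.
have ball_d x y r : 0 < r -> ball (x : X) r (y : X) -> d x y <= r.
  by move=> r0 xy; apply: ge_inf; [case: (radii_inf x y) | split].
have ballV n : exists2 r : R, 0 < r &
    forall x y, ball (x : X) r (y : X) -> V n x y.
  have : entourage [set xy : X * X | V n xy.1 xy.2] by exists n.
  rewrite -entourage_ballE => -[r /= r0 rV]; exists r => // x y xy.
  exact: (rV (x, y)).
have dV n : exists2 r, 0 < r & forall x y, d x y < r -> V n x y.
  by have [r r0 rV] := ballV n; exists r => // x y /d_ball /rV.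
exists d; split=> //.
- split.
  + move=> x; apply/eqP; rewrite eq_le; apply/andP; split.
      apply/ler_addgt0Pl => e e0; rewrite addr0.
      by apply: ball_d => //; exact: ballxx.
    by apply: lb_le_inf; [case: (radii_inf x x) | exact: radii_lb].
  + by move=> x y d0; apply: V_sep => n; have [r r0] := dV n; apply; rewrite d0.
  + move=> x y; rewrite /d; congr inf.
    by apply/seteqP; split=> r [r0 /ball_sym].
  + move=> y x z; apply/ler_addgt0Pl => e e0.
    have e20 : 0 < e / 2 by rewrite divr_gt0.
    have dge0 u v : 0 <= d u v.
      by apply: lb_le_inf; [case: (radii_inf u v) | exact: radii_lb].
    have -> : e + (d x y + d y z) = (d x y + e / 2) + (d y z + e / 2) by field.
    apply: ball_d.
      by rewrite addr_gt0// ltr_wpDl.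
    by apply: (@ball_triangle _ X y); apply: d_ball; rewrite ltrDl.
- move=> r r0; have r20 : 0 < r / 2 by rewrite divr_gt0.
  have : entourage [set xy : X * X | ball xy.1 (r / 2) xy.2].
    by rewrite -entourage_ballE; exists (r / 2).
  move=> [n _ nV]; exists n => x y /(nV (x, y)) /= /(ball_d _ _ _ r20) xy.
  by apply: le_lt_trans xy _; rewrite ltr_pdivrMr// ltr_pMr// ltr1n.
Qed.

End CountableBase.

(** * Compactness and compatible metrics *)

(** Otherwise the closed sets [C n] minus [O] generate a proper filter, and a cluster point of it
    lies in every [C n] but not in [O]. Every compactness argument below goes through this form. *)
Lemma compact_closed_decr (T : topologicalType) (C : nat -> set T) (O : set T) :
  compact [set: T] -> (forall n, closed (C n)) ->
  (forall m n, (m <= n)%N -> C n `<=` C m) ->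
  open O -> \bigcap_n C n `<=` O -> exists n, C n `<=` O.
Proof.
move=> cT Cc Cd Oo CO; apply: contrapT => /forallNP nCO.
pose F := filter_from [set: nat] (fun n => C n `&` ~` O).
have FF : ProperFilter F.
  apply: filter_from_proper.
    apply: filter_from_filter; first by exists 0%N.
    move=> i j _ _; exists (maxn i j) => // x [Cx nOx].
    by split; split=> //; apply: Cd Cx; rewrite ?leq_maxl ?leq_maxr.
  by move=> n _; apply/set0P/negP => /eqP CO0; apply: (nCO n); exact/subsets_disjoint.
have [p [_ Fp]] := cT F FF filterT.
have CFp n : (C n `&` ~` O) p.
  have CnO : closed (C n `&` ~` O) by apply: closedI => //; exact: open_closedC.
  rewrite ((closure_id _).1 CnO) => A pA; apply: Fp pA.
  by exists n.
by case: (CFp 0%N) => _; apply; apply: CO => n _; case: (CFp n).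
Qed.

Section CompatibleMetric.
Variables (R : realType) (T : topologicalType) (d : T -> T -> R).

Lemma is_metric_ge0 (dm : is_metric d) x y : 0 <= d x y.
Proof.
rewrite -(@pmulrn_lge0 _ _ 2)// -(is_metric_xx dm x).
by rewrite (le_trans (is_metric_triangle dm y _ _))// (is_metric_sym dm y) mulr2n.
Qed.

Lemma compatible_metricP : is_metric d ->
  (forall x r, 0 < r -> nbhs x [set y | d x y < r]) ->
  (forall x A, nbhs x A -> exists2 r, 0 < r & [set y | d x y < r] `<=` A) ->
  compatible_metric d.
Proof.
move=> dm dn nd; split=> //; apply/funext => x; apply/seteqP; split=> A.
  by move=> /nd [r r0 rA]; exists r.
by move=> [r r0 rA]; apply: filterS rA _; exact: dn.
Qed.

Hypothesis dT : compatible_metric d.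
Let dm : is_metric d := dT.1.

Lemma compatible_nbhs_ball x r : 0 < r -> nbhs x [set y | d x y < r].
Proof. by rewrite dT.2 => r0; exists r. Qed.

Lemma compatible_nbhsP x A : nbhs x A ->
  exists2 r, 0 < r & [set y | d x y < r] `<=` A.
Proof. by rewrite dT.2 => -[r r0 rA]; exists r. Qed.

Lemma compatible_metric_continuous : continuous (fun xy : T * T => d xy.1 xy.2).
Proof.
move=> [x y]; apply/cvgrPdist_lt => e e0 /=.
have e20 : 0 < e / 2 by rewrite divr_gt0.
exists ([set u | d x u < e / 2], [set v | d y v < e / 2]).
  by split; exact: compatible_nbhs_ball.
move=> [u v] [/= xu yv].
have := is_metric_triangle dm u x y; have := is_metric_triangle dm v u y.
have := is_metric_triangle dm x u v; have := is_metric_triangle dm y x v.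
rewrite (is_metric_sym dm u x) (is_metric_sym dm v y) ltr_norml.
by move=> *; apply/andP; split; lra.
Qed.

Lemma compact_bounded_metric : compact [set: T] ->
  exists2 K, 0 < K & forall x y, d x y <= K.
Proof.
move=> cT; have cTT : compact [set: T * T].
  by rewrite -setXTT; exact: compact_setX.
(* The closed sets where [d] is at least [n] decrease to the empty set, so one of them is empty. *)
have [||||n nK] :=
    @compact_closed_decr _ (fun n => [set xy : T * T | n%:R <= d xy.1 xy.2]) set0 cTT.
- move=> n; have := (continuous_closedP _).1 compatible_metric_continuous.
  by move=> /(_ [set r | n%:R <= r]); apply; exact: closed_ge.
- by move=> m n mn xy /=; apply: le_trans; rewrite ler_nat.
- exact: open0.
- move=> xy /= dxy; have := dxy (Num.truncn (d xy.1 xy.2)).+1 I.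
  by rewrite /= leNgt truncnS_gt.
- exists n.+1%:R => // x y; rewrite leNgt; apply/negP => nxy.
  by apply: (nK (x, y)) => /=; apply: le_trans (ltW nxy); rewrite ler_nat.
Qed.

End CompatibleMetric.

(** * Integer iterates of a homeomorphism *)

Section Iterates.
Variables (T : topologicalType) (g : homeo T).

Lemma iterzS n x : iterz g (n + 1) x = g (iterz g n x).
Proof.
case: n => [k|[|k]]; first by rewrite -PoszD addn1.
  by rewrite /= homeo_invK.
have -> : Negz k.+1 + 1 = Negz k by lia.
by rewrite /= homeo_invK.
Qed.

Lemma iterzD m n x : iterz g (m + n) x = iterz g m (iterz g n x).
Proof.
elim/int_rect: m => [|m IH|m IH]; first by rewrite add0r.
  have -> : m.+1%:Z + n = m%:Z + n + 1 by lia.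
  have -> : m.+1%:Z = m%:Z + 1 by lia.
  by rewrite !iterzS IH.
(* Going down from [- m] to [- m.+1] is checked after applying the injective [g], which reduces it
   to the step up. *)
apply: (can_inj (homeo_funK g)); rewrite -!iterzS.
have -> : - m.+1%:Z + n + 1 = - m%:Z + n by lia.
by have -> : - m.+1%:Z + 1 = - m%:Z by lia.
Qed.

Lemma iterz_continuous n : continuous (iterz g n).
Proof.
have iter_continuous (h : T -> T) k : continuous h -> continuous (iter k h).
  move=> ch; elim: k => [|k IH] x; first exact: cvg_id.
  by apply: (@continuous_comp _ _ _ (iter k h) h); [exact: IH | exact: ch].
by case: n => k; apply: iter_continuous;
  [exact: homeo_fun_continuous | exact: homeo_inv_continuous].
Qed.

End Iterates.

(** * Bowen relations on finite time windows *)

Section Bowen.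
Variables (R : realType) (T : topologicalType) (d : T -> T -> R) (g : homeo T).

(** The window is two-sided and the inequality is not strict: the relations are then closed and
    decrease to [orbit_close], as compactness requires. *)
Definition bowen (r : R) (n : nat) (x y : T) : Prop :=
  forall i : int, (`|i| <= n)%N -> d (iterz g i x) (iterz g i y) <= r.

Lemma bowen_le r m n x y : (m <= n)%N -> bowen r n x y -> bowen r m x y.
Proof. by move=> mn xy i im; apply: xy; exact: leq_trans mn. Qed.

Lemma bowen_iterz r m n i x y : (`|i| <= m)%N -> bowen r (n + m) x y ->
  bowen r n (iterz g i x) (iterz g i y).
Proof. by move=> im xy j jn; rewrite -!iterzD; apply: xy; lia. Qed.

Lemma iterz_bowen r m n x y :
  (forall i, (`|i| <= n)%N -> bowen r m (iterz g i x) (iterz g i y)) ->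
  bowen r n x y.
Proof. by move=> xy i /xy /(_ 0); exact. Qed.

Lemma orbit_close_bowen r x y :
  orbit_close d g r x y <-> forall n, bowen r n x y.
Proof. by split=> [xy n i _|xy n]; [exact: xy | exact: (xy `|n|%N)]. Qed.

Lemma orbit_close_iterz r i x y :
  orbit_close d g r x y -> orbit_close d g r (iterz g i x) (iterz g i y).
Proof. by move=> xy n; rewrite -!iterzD. Qed.

Section Metric.
Hypothesis dm : is_metric d.

Lemma bowen_refl r n x : 0 <= r -> bowen r n x x.
Proof. by move=> r0 i _; rewrite is_metric_xx. Qed.

Lemma bowen_sym r n x y : bowen r n x y -> bowen r n y x.
Proof. by move=> xy i /xy; rewrite is_metric_sym. Qed.

End Metric.

Hypothesis dT : compatible_metric d.

Lemma closed_bowen r n : closed [set xy : T * T | bowen r n xy.1 xy.2].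
Proof.
have -> : [set xy : T * T | bowen r n xy.1 xy.2] =
    \bigcap_(i in [set i : int | (`|i| <= n)%N])
      [set xy | d (iterz g i xy.1) (iterz g i xy.2) <= r] by [].
apply: closed_bigI => i _.
have ci : continuous (fun xy : T * T => d (iterz g i xy.1) (iterz g i xy.2)).
  move=> xy; apply: (@continuous_comp _ _ _
    (fun xy : T * T => (iterz g i xy.1, iterz g i xy.2)) (fun xy => d xy.1 xy.2)).
    apply: cvg_pair.
      by apply: (@continuous_comp _ _ _ fst (iterz g i));
        [exact: cvg_fst | exact: iterz_continuous].
    by apply: (@continuous_comp _ _ _ snd (iterz g i));
      [exact: cvg_snd | exact: iterz_continuous].
  exact: compatible_metric_continuous.
have := (continuous_closedP _).1 ci.
by move=> /(_ [set s | s <= r]); apply; exact: closed_le.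
Qed.

Lemma nbhs_bowen r n x : 0 < r -> nbhs x [set y | bowen r n x y].
Proof.
move=> r0; have near_iterz i : \forall y \near x, d (iterz g i x) (iterz g i y) <= r.
  have /(@iterz_continuous _ g i x) := compatible_nbhs_ball dT (iterz g i x) r0.
  by rewrite nbhs_simpl /=; apply: filterS => y /ltW.
elim: n => [|n IH].
  apply: filterS (near_iterz 0) => y xy i.
  by rewrite leqn0 absz_eq0 => /eqP ->.
apply: filterS3 IH (near_iterz n.+1) (near_iterz (- n.+1%:Z)) => y xy xSy xNSy i.
rewrite leq_eqVlt => /orP[/eqP iSn|]; last by rewrite ltnS; exact: xy.
have [->|->] : i = n.+1 \/ i = - n.+1%:Z by lia.
  exact: xSy.
exact: xNSy.
Qed.

End Bowen.

Lemma iterz_quot (T : topologicalType) (f : homeo T) (E : equiv_rel T)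
    (fE : compatible_rel f E) n x :
  iterz (quot_homeo fE) n (\pi_(quot_space E) x) = \pi_(quot_space E) (iterz f n x).
Proof.
have quot_succ m y : \pi_(quot_space E) (iterz f (m + 1) y) =
    quot_homeo fE (\pi_(quot_space E) (iterz f m y)).
  by rewrite iterzS quot_homeoE.
elim/int_rect: n => [//|n IH|n IH].
  have -> : n.+1%:Z = n%:Z + 1 by lia.
  by rewrite iterzS IH quot_succ.
apply: (can_inj (homeo_funK (quot_homeo fE))); rewrite -iterzS -quot_succ.
by have -> : - n.+1%:Z + 1 = - n%:Z by lia.
Qed.

(** * The quotient of a semi-Anosov homeomorphism *)

Section QuotientByOrbitCloseness.
Variables (R : realType) (M : topologicalType) (f : homeo M) (d : M -> M -> R).
Variables (E : equiv_rel M) (alpha c : R).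
Hypothesis cM : compact [set: M].
Hypothesis dM : compatible_metric d.
Hypotheses (c0 : 0 < c) (calpha : c <= alpha).
Hypothesis E_orbit : forall x y, E x y <-> orbit_close d f alpha x y.
Hypothesis E_lt : forall x y, E x y -> d x y < c.

Let dm : is_metric d := dM.1.
Let pi := \pi_(quot_space E).
Let U := bowen d f c.

Let U_le m n x y : (m <= n)%N -> U n x y -> U m x y.
Proof. exact: bowen_le. Qed.

Let U_refl n x : U n x x.
Proof. by apply: bowen_refl => //; exact: ltW. Qed.

Let U_sym n x y : U n x y -> U n y x.
Proof. exact: bowen_sym. Qed.

Let E_U n x y : E x y -> U n x y.
Proof.
move=> /E_orbit xy i _; apply/ltW/E_lt/E_orbit.
exact: orbit_close_iterz.
Qed.

Let U_E x y : (forall n, U n x y) -> E x y.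
Proof.
move=> /orbit_close_bowen xy; apply/E_orbit => n.
exact: le_trans (xy n) calpha.
Qed.

Let cMM : compact [set: M * M].
Proof. by rewrite -setXTT; exact: compact_setX. Qed.

Let open_d_lt : open [set xy : M * M | d xy.1 xy.2 < c].
Proof.
have := (continuousP _).1 (compatible_metric_continuous dM).
by move=> /(_ [set r | r < c]); apply; exact: open_lt.
Qed.

(** The [alpha]-relations decrease to [E], which lies in the open set where [d < c], so some window
    [m] already forces [d < c]. Applying this to the iterates of order at most [n] costs [n] more in
    the window. *)
Lemma bowen_expansive n :
  exists m, forall x y, bowen d f alpha m x y -> U n x y.
Proof.
have [||||m mO] := @compact_closed_decr _
    (fun m => [set xy : M * M | bowen d f alpha m xy.1 xy.2])
    [set xy | d xy.1 xy.2 < c] cMM.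
- by move=> m; exact: closed_bowen.
- by move=> i j ij xy; exact: bowen_le.
- exact: open_d_lt.
- move=> [x y] /= xy; apply/E_lt/E_orbit/orbit_close_bowen => k.
  exact: (xy k I).
exists (m + n)%N => x y xy; apply: (@iterz_bowen _ _ _ _ _ 0%N) => i iN j.
rewrite leqn0 absz_eq0 => /eqP ->; apply/ltW.
exact: (mO (_, _)) (bowen_iterz iN xy).
Qed.

(** Same scheme on triples: in the limit both pairs are [E]-equivalent, so transitivity of [E] puts
    the outer pair in [d < c]. *)
Lemma bowen_split n : exists m, forall x y z, U m x y -> U m y z -> U n x z.
Proof.
pose xy_ (p : M * M * M) := p.1.
pose yz_ (p : M * M * M) := (p.1.2, p.2).
pose xz_ (p : M * M * M) := (p.1.1, p.2).
have cxy : continuous xy_ by move=> p; exact: cvg_fst.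
have cyz : continuous yz_.
  move=> p; apply: cvg_pair; last exact: cvg_snd.
  by apply: (@continuous_comp _ _ _ fst snd); [exact: cvg_fst | exact: cvg_snd].
have cxz : continuous xz_.
  move=> p; apply: cvg_pair; last exact: cvg_snd.
  by apply: (@continuous_comp _ _ _ fst fst); exact: cvg_fst.
have cMMM : compact [set: M * M * M].
  by rewrite -setXTT; exact: compact_setX.
have [||||m mO] := @compact_closed_decr _
    (fun m => xy_ @^-1` [set xy | U m xy.1 xy.2] `&`
              yz_ @^-1` [set xy | U m xy.1 xy.2])
    (xz_ @^-1` [set xy | d xy.1 xy.2 < c]) cMMM.
- move=> m; apply: closedI; apply: (continuous_closedP _).1 => //;
  exact: closed_bowen.
- by move=> i j ij p [xy yz]; split; exact: U_le ij _.
- by apply: (continuousP _).1.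
- move=> p Up; apply: E_lt; apply: (@equiv_trans _ E p.1.2).
    by apply: U_E => k; have [] := Up k I.
  by apply: U_E => k; have [] := Up k I.
exists (m + n)%N => x y z xy yz; apply: (@iterz_bowen _ _ _ _ _ 0%N) => i iN j.
rewrite leqn0 absz_eq0 => /eqP ->; apply/ltW.
by apply: (mO (_, iterz f i y, _)); split; exact: bowen_iterz iN _.
Qed.

(** Changing representatives inserts [E]-links, which are [U]-links; the chains arising below have
    three links, completed by a reflexive one. *)
Lemma bowen_split4 n : exists m, forall x y z t w,
  U m x y -> U m y z -> U m z t -> U m t w -> U n x w.
Proof.
have [k kn] := bowen_split n; have [m mk] := bowen_split k.
by exists m => x y z t w xy yz zt tw; apply: (kn _ z); [exact: mk yz | exact: mk tw].
Qed.

Lemma quot_metric : exists D : quot_space E -> quot_space E -> R,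
  [/\ compatible_metric D,
    forall n, exists2 r, 0 < r & forall x y, D (pi x) (pi y) < r -> U n x y
    & forall r, 0 < r -> exists n, forall x y, U n x y -> D (pi x) (pi y) < r].
Proof.
(* The images of the [U n] in the quotient; [V_U] shows that, up to a shift of index, they do not
   depend on the representatives. *)
pose V n (p q : quot_space E) := exists x y, [/\ pi x = p, pi y = q & U n x y].
have V_U n : exists m, forall x y, V m (pi x) (pi y) -> U n x y.
  have [m mn] := bowen_split4 n; exists m => x y [x' [y' [xx' yy' x'y']]].
  apply: (mn x x' y' y) => //; apply: E_U; last exact/quot_piP.
  by apply/quot_piP; rewrite -/pi xx'.
have [|||||D [Dm DV VD]] := @countable_base_metric _ V _ _ _ _ R.
- by move=> n p; exists (repr p), (repr p); rewrite /pi reprK.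
- by move=> n p q [x [y [xp yq xy]]]; exists y, x; split=> //; exact: U_sym.
- move=> m n p q mn [x [y [xp yq xy]]]; exists x, y; split=> //; exact: U_le xy.
- move=> n; have [m mn] := bowen_split4 n; exists m.
  move=> p q s [x [y [xp yq xy]]] [y' [z [yq' zs yz]]].
  exists x, z; split=> //; apply: (mn x y y' z) => //.
  by apply: E_U; apply/quot_piP; rewrite -/pi yq.
- move=> p q pq; rewrite -(reprK p) -(reprK q); apply/quot_piP/U_E => n.
  by have [m] := V_U n; apply; rewrite /pi !reprK.
have D_U n : exists2 r, 0 < r & forall x y, D (pi x) (pi y) < r -> U n x y.
  have [m mn] := V_U n; have [r r0 rm] := DV m.
  by exists r => // x y /rm /mn.
have U_D r : 0 < r -> exists n, forall x y, U n x y -> D (pi x) (pi y) < r.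
  by move=> /VD [n nr]; exists n => x y xy; apply: nr; exists x, y.
exists D; split=> //; apply: compatible_metricP => //.
- move=> p r r0.
  have oB : open [set q | D p q < r].
    (* In the quotient topology a set is open exactly when its preimage is. *)
    suff : open (pi @^-1` [set q | D p q < r]) by [].
    rewrite openE => x /= px.
    have [n nr] : exists n, forall y, U n x y -> D (pi x) (pi y) < r - D p (pi x).
      by have [|n nr] := U_D (r - D p (pi x)); [rewrite subr_gt0 | exists n => y /nr].
    apply: filterS (nbhs_bowen f dM n x c0) => y /nr /= xy.
    by have := is_metric_triangle Dm (pi x) p (pi y); lra.
  by apply: open_nbhs_nbhs; split=> //=; rewrite is_metric_xx.
- move=> p A; rewrite nbhsE => -[O [oO Op] OA].
  (* The sections of the [U m] at [repr p] decrease to its class, which lies in the open preimage of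
     [O]. *)
  have [||||m mO] := @compact_closed_decr _
    (fun m => [set y | U m (repr p) y]) (pi @^-1` O) cM.
  + move=> m; apply: ((continuous_closedP (fun y => (repr p, y))).1 _
      [set xy | U m xy.1 xy.2]).
      by move=> y; apply: cvg_pair; [exact: cvg_cst | exact: cvg_id].
    exact: closed_bowen.
  + by move=> i j ij y; exact: U_le.
  + exact: oO.
  + move=> y py; have /quot_piP : E (repr p) y by apply: U_E => n; exact: py n I.
    by rewrite reprK /preimage /= /pi => <-.
  have [r r0 rm] := D_U m; exists r => // q /= pq.
  apply: OA; rewrite -(reprK q); apply: mO; apply: rm.
  by rewrite /pi !reprK.
Qed.

(** Induction on [K]: one more application of [f] shifts the window by one, hence the index [k + 1],
    and [bowen_split] absorbs the additional jump. *)
Lemma pseudo_orbit_drift K n : exists m, forall x : int -> M,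
  (forall i, U m (f (x i)) (x (i + 1))) ->
  forall (j : nat) i, (j <= K)%N -> U n (iterz f j (x i)) (x (i + j)).
Proof.
elim: K n => [|K IH] n.
  by exists 0%N => x _ j i; rewrite leqn0 => /eqP ->; rewrite addr0.
have [k kn] := bowen_split n; have [m mK] := IH (maxn n (k + 1)).
exists (maxn m k) => x xm j i.
have xK j' : (j' <= K)%N -> U (maxn n (k + 1)) (iterz f j' (x i)) (x (i + j')).
  by move=> j'K; apply: mK j'K => i'; exact: U_le (leq_maxl _ _) (xm i').
rewrite leq_eqVlt => /orP[/eqP ->|]; last first.
  by rewrite ltnS => /xK; apply: U_le; exact: leq_maxl.
apply: (kn _ (f (x (i + K)))).
  have -> : iterz f K.+1 (x i) = iterz f 1 (iterz f K (x i)) by [].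
  have -> : f (x (i + K)) = iterz f 1 (x (i + K)) by [].
  apply: (@bowen_iterz _ _ _ _ _ 1) => //.
  by apply: U_le (xK K (leqnn K)); exact: leq_maxr.
have -> : i + K.+1%:Z = i + K + 1 by lia.
exact: U_le (leq_maxr _ _) (xm _).
Qed.

(* Following the orbit of [p] for time [i], the point [x (n + i)] deviates by at
   most [c] from [f^i (x n)], so [alpha / 4]-shadowing makes the orbit segments of
   [f^n p] and [x n] [alpha]-close on a long time window. *)
Lemma shadowing_bowen delta : c < delta -> c <= 3 / 4 * alpha ->
  eps_delta_shadowing d f (alpha / 4) delta ->
  forall n, exists m, forall x : int -> M,
    (forall i, U m (f (x i)) (x (i + 1))) ->
    exists p, forall i, U n (iterz f i p) (x i).
Proof.
move=> cdelta c34 fsh n; have [K Kn] := bowen_expansive n.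
(* The first [K] bounds the number of steps; the second keeps the estimate valid at times down to
   [- K], as needed for negative [j]. *)
have [m mK] := pseudo_orbit_drift K K.
exists m => x xm; have [|p px] := fsh x.
  by move=> i; apply: le_lt_trans cdelta; exact: (xm i 0).
exists p => i; apply: Kn => j jK.
rewrite -iterzD.
have pxij := px (j + i).
suff xij : d (x (j + i)) (iterz f j (x i)) <= c.
  by have := is_metric_triangle dm (x (j + i)) (iterz f (j + i) p) (iterz f j (x i)); lra.
rewrite is_metric_sym//; case: j jK {pxij} => [j|j] jK.
  by have := mK x xm j i jK 0; rewrite addrC; exact.
(* For a negative time the drift runs forward from [x (Negz j + i)] to [x i], and is then read at
   time [Negz j]. *)
have := mK x xm j.+1 (Negz j + i) jK (Negz j) jK; rewrite -iterzD.
have -> : Negz j + j.+1%:Z = 0 by lia.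
have -> : Negz j + i + j.+1%:Z = i by lia.
by rewrite is_metric_sym.
Qed.

Hypothesis fE : compatible_rel f E.

Lemma quot_anosov delta : c < delta -> c <= 3 / 4 * alpha ->
  eps_delta_shadowing d f (alpha / 4) delta -> anosov R (quot_homeo fE).
Proof.
move=> cdelta c34 fsh; have [D [DQ DU UD]] := quot_metric.
exists D; split=> //.
(* Halving [r] turns the non-strict bound of expansiveness into the strict one of [DU]; window 0 at
   every time gives orbits [c]-close. *)
- have [r r0 r_U] := DU 0%N; exists (r / 2); first by rewrite divr_gt0.
  move=> p q; rewrite -(reprK p) -(reprK q) => pq.
  apply/quot_piP/E_orbit => n; apply: le_trans calpha.
  have /r_U /(_ 0) : D (pi (iterz f n (repr p))) (pi (iterz f n (repr q))) < r.
    rewrite /pi -!(iterz_quot fE); apply: le_lt_trans (pq n) _.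
    by rewrite ltr_pdivrMr// ltr_pMr// ltr1n.
  exact.
- move=> eps /UD [n n_eps]; have [m m_sh] := shadowing_bowen cdelta c34 fsh n.
  have [r r0 r_U] := DU m; exists r => // q qr.
  (* Any lift of the pseudo-orbit works, since [D]-closeness of classes gives [U m] for all
     representatives. *)
  have [|p px] := m_sh (repr \o q).
    by move=> i; apply: r_U; rewrite /pi -(quot_homeoE fE) /= !reprK; exact: qr.
  exists (pi p) => i; rewrite /pi iterz_quot -(reprK (q i)).
  exact: n_eps (px i).
Qed.

End QuotientByOrbitCloseness.

(** * The equivalence and the metric adapted to the quotient *)

Theorem theorem4p6 (R : realType) (M : topologicalType)
    (cM : compact [set: M]) (mM : metrizable R M)
    (f : homeo M) (E : equiv_rel M) (fE : compatible_rel f E) :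
  anosov R (quot_homeo fE) <->
  exists d : M -> M -> R, compatible_metric d /\
    exists alpha : R, [/\ 0 < alpha, semi_anosov d f alpha
      & forall x y, E x y <-> orbit_close d f alpha x y].
Proof.
split; last first.
  move=> [d [dM [alpha [alpha0 [delta [/andP[delta0 delta_le] fexp fsh]] E_orbit]]]].
  apply: (@quot_anosov _ _ _ d _ alpha (delta / 4) _ _ _ _ E_orbit _ fE delta) => //.
  - by rewrite divr_gt0.
  - lra.
  - by move=> x y /E_orbit; exact: fexp.
  - lra.
  - lra.
move=> [D [DQ [alpha alpha0 Dexp] Dsh]]; have [d dM] := mM.
have Dm := DQ.1; have dm := dM.1.
have [delta' delta'0 fsh] : exists2 delta, 0 < delta &
    eps_delta_shadowing D (quot_homeo fE) (alpha / 4) delta.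
  by apply: Dsh; rewrite divr_gt0.
pose delta := Num.min delta' (alpha / 4).
have delta0 : 0 < delta by rewrite lt_min delta'0 divr_gt0.
have delta_alpha : delta <= alpha / 4 by rewrite ge_min lexx orbT.
have [K K0 dK] := compact_bounded_metric dM cM.
(* With [d] at most [K], the scaled distance is at most [delta / 8]. *)
pose k := delta / (8 * K).
have k0 : 0 < k by rewrite divr_gt0// mulr_gt0.
pose pi := \pi_(quot_space E)%qT.
have kd x y : k * d x y < delta / 4.
  have : k * d x y <= k * K by rewrite ler_pM2l.
  have -> : k * K = delta / 8 by rewrite /k; field; rewrite gt_eqF.
  by move=> ?; lra.
(* The first term carries the dynamics of the quotient; the second separates points of one class and
   restores the topology of [M]. *)
pose e x y := Num.max (D (pi x) (pi y)) (k * d x y).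
have e_iterz x y n : e (iterz f n x) (iterz f n y) <= alpha =
    (D (iterz (quot_homeo fE) n (pi x)) (iterz (quot_homeo fE) n (pi y)) <= alpha).
  rewrite /e ge_max !iterz_quot andbC; have := kd (iterz f n x) (iterz f n y).
  by move=> kxy; have -> : k * d (iterz f n x) (iterz f n y) <= alpha by lra.
have E_orbit x y : E x y <-> orbit_close e f alpha x y.
  split=> [/quot_piP xy n|xy].
    by rewrite e_iterz /pi xy is_metric_xx//; exact: ltW.
  by apply/quot_piP/Dexp => n; rewrite -e_iterz; exact: xy.
have em : is_metric e.
  split.
  - by move=> x; rewrite /e !is_metric_xx// mulr0 maxxx.
  - move=> x y e0; apply: (is_metric_eq dm); apply/eqP.
    rewrite eq_le (is_metric_ge0 dm) andbT -(pmulr_rle0 _ k0) -e0.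
    by rewrite /e le_max lexx orbT.
  - by move=> x y; rewrite /e (is_metric_sym Dm) (is_metric_sym dm).
  - move=> y x z; rewrite /e ge_max; apply/andP; split.
      apply: le_trans (is_metric_triangle Dm (pi y) _ _) _.
      by rewrite lerD// le_max lexx.
    apply: (@le_trans _ _ (k * d x y + k * d y z)).
      by rewrite -mulrDr ler_pM2l//; exact: is_metric_triangle.
    by rewrite lerD// le_max lexx orbT.
exists e; split.
  apply: compatible_metricP => //.
  - move=> x r r0; have rk0 : 0 < r / k by rewrite divr_gt0.
    have D_near : nbhs x (pi @^-1` [set q | D (pi x) q < r]).
      exact: (@pi_continuous _ {eq_quot E}%qT) (compatible_nbhs_ball DQ (pi x) r0).
    apply: filterS2 D_near (compatible_nbhs_ball dM x rk0) => y /= Dxy dxy.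
    by rewrite /e gt_max Dxy mulrC -ltr_pdivlMr.
  - move=> x A /(compatible_nbhsP dM) [r r0 rA].
    exists (k * r); first by rewrite mulr_gt0.
    by move=> y; rewrite /= /e gt_max => /andP[_]; rewrite ltr_pM2l// => /rA.
exists alpha; split=> //; exists delta; split.
- by rewrite delta0.
(* Within a class the [D] term vanishes, leaving only the scaled distance. *)
- move=> x y /E_orbit/quot_piP xy.
  by rewrite /e /pi xy is_metric_xx// gt_max kd divr_gt0.
- move=> x ox; have [|q qx] := fsh (pi \o x).
    move=> n; rewrite /comp quot_homeoE.
    by have := ox n; rewrite /e gt_max lt_min => /andP[/andP[]].
  (* Any lift of [q] shadows: the scaled distance is below [delta / 4], hence below [alpha / 4]. *)
  exists (repr q) => n; rewrite /e gt_max; apply/andP; split.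
    by have := qx n; rewrite -[q in iterz _ n q]reprK iterz_quot.
  by have := kd (iterz f n (repr q)) (x n); lra.
Qed.
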